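(* Let $\mathcal{H}$ be a complex Hilbert space and let $T$ be a bounded linear operator on $\mathcal{H}$. Suppose that $T^n=0$, where $n\geq 2$ is the least positive integer with this property. Then $$w(T) \leq \left(\sum_{k=1}^{n-1} \frac{1}{2^{k}} \left\|T^k\right\| \left\|T\right\|^{n-k}\right)^{1/n} \leq \left(1-\frac{1}{2^{n-1}}\right)^{1/n}\|T\|.$$
   Context: For a bounded linear operator $A$ on $\mathcal{H}$, $\|A\|$ denotes the usual operator norm and $w(A)=\sup\{|\langle Ax,x\rangle| : x\in\mathcal{H},\ \|x\|=1\}$ denotes the numerical radius. *)

(* Defs.v *)
From mathcomp Require Import all_boot all_order all_algebra.
From mathcomp Require Import complex.
From mathcomp Require Import all_classical all_reals all_analysis.

Set Implicit Arguments.
Unset Strict Implicit.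
Unset Printing Implicit Defensive.

Import Order.TTheory GRing.Theory Num.Theory.
Import numFieldNormedType.Exports.

Local Open Scope classical_set_scope.
Local Open Scope complex_scope.
Local Open Scope ring_scope.

(* In a normed module over R[i] the norm takes values in R[i]; these values are
   nonnegative, hence real, and [rnorm] reads them in R. *)
Definition rnorm (R : realType) (V : normedZmodType R[i]) (x : V) : R :=
  complex.Re `|x|.

Definition bounded_operator (R : realType) (H : normedModType R[i])
    (A : H -> H) : Prop :=
  exists M : R, forall x : H, rnorm (A x) <= M * rnorm x.

(* The closed unit ball is used rather than the unit sphere, so that the set is
   nonempty even when H is the zero space. *)
Definition opnorm (R : realType) (H : normedModType R[i]) (A : H -> H) : R :=
  sup [set rnorm (A x) | x in [set x : H | rnorm x <= 1]].

Definition numerical_radius (R : realType) (H : normedModType R[i])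
    (dot : H -> H -> R[i]) (A : H -> H) : R :=
  sup [set rnorm (dot (A x) x) | x in [set x : H | rnorm x = 1]].

(* Main.v *)
From HB Require Import structures.
Require Import Defs.
From mathcomp Require Import all_boot all_order all_algebra.
From mathcomp Require Import complex.
From mathcomp Require Import all_classical all_reals all_analysis.
From mathcomp Require Import ring lra.

(** For a unit vector [e], put [a_k = |<T^k e, e>|]. Reflecting [z = T e] in the
    line of [e] gives [2 <z,e> e - z], a vector of norm [|z|]; applying [T^k] to
    it and pairing with [e] shows
    [2 a_1 a_k <= a_{k+1} + |T^k| |T|] ([Buzano_operator]). So multiplying
    by [a_1] trades the power [T^k] for [T^{k+1}] at the price of a factor 1/2
    and of an error term, and starting from [a_1] one reaches
    [a_1^n <= sum_{1 <= k < n} 2^{-k} |T^k| |T|^{n-k} + 2^{-(n-1)} a_n]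
    ([rnorm_dot_expr_le]). When [T^n = 0] the last term vanishes, and the
    supremum over [e] of the [n]-th roots is the first inequality.

    The second one follows from [|T^k| <= |T|^k] ([opnorm_iter_le]), which
    bounds every summand by [2^{-k} |T|^n], and from the geometric sum
    [sum_halves]. *)

Import Order.TTheory GRing.Theory Num.Theory.
Import numFieldNormedType.Exports.
Local Open Scope complex_scope.
Local Open Scope ring_scope.

Set Implicit Arguments.
Unset Strict Implicit.

(** * Positive definite Hermitian forms *)

Section DotForm.
Variables (C : numClosedFieldType) (U : lmodType C).
Variable dot : {dot U for @Num.conj C}.

Lemma dotBl (u v w : U) : dot (u - v) w = dot u w - dot v w.
Proof. exact: linearBl. Qed.

Lemma dotBr (u v w : U) : dot w (u - v) = dot w u - dot w v.
Proof. exact: linearBr. Qed.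

Lemma dotZl a (u v : U) : dot (a *: u) v = a * dot u v.
Proof. exact: linearZl_LR. Qed.

Lemma dotZr a (u v : U) : dot u (a *: v) = a^* * dot u v.
Proof. exact: linearZr_LR. Qed.

(** The vector [u - (<u,v>/<v,v>) v] is the component of [u] orthogonal to
    [v]; expanding its nonnegative square gives the inequality. *)
Lemma dot_CauchySchwarz (u v : U) :
  `|dot u v| ^+ 2 <= dot u u * dot v v.
Proof.
have [->|v_neq0] := eqVneq v 0.
  by rewrite !linear0r normr0 expr0n.
have vv_gt0 : 0 < dot v v by rewrite dnorm_gt0.
rewrite -ler_pdivrMr// -subr_ge0.
suff -> : dot u u - `|dot u v| ^+ 2 / dot v v =
          dot (u - (dot u v / dot v v) *: v) (u - (dot u v / dot v v) *: v).
  exact: dnorm_ge0.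
have vv_real : (dot v v)^* = dot v v by apply: geC0_conj; exact: ltW.
have vuE : dot v u = (dot u v)^* by rewrite (hermC dot) expr0 mul1r.
rewrite dotBl !dotBr !dotZl !dotZr vuE normCK.
rewrite rmorphM fmorphV /= vv_real.
by field; rewrite gt_eqF.
Qed.

(** The map [z |-> 2 <z,e> e - z] fixes [e] and negates the orthogonal
    complement of [e], hence it preserves the norm. *)
Lemma dnorm_line_reflection (e z : U) : dot e e = 1 ->
  dot ((2 * dot z e) *: e - z) ((2 * dot z e) *: e - z) = dot z z.
Proof.
move=> ee1; have ezE : dot e z = (dot z e)^* by rewrite (hermC dot) expr0 mul1r.
rewrite dotBl !dotBr !dotZl !dotZr ee1 ezE.
by rewrite rmorphM rmorph_nat; ring.
Qed.

End DotForm.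

(** * The real-valued norm and the operator norm *)

Section RealNorm.
Variable R : realType.
Implicit Types V : normedZmodType R[i].

Lemma rnormE V (x : V) : (rnorm x)%:C = `|x|.
Proof. by apply: RRe_real; apply: ger0_real; exact: (@normr_ge0 R[i] V x). Qed.

Lemma rnorm_ge0 V (x : V) : 0 <= rnorm x.
Proof. by rewrite -lecR rnormE; exact: (@normr_ge0 R[i] V x). Qed.

Lemma rnorm0 V : rnorm (0 : V) = 0.
Proof. by apply: complexI; rewrite rnormE; exact: (@normr0 R[i] V). Qed.

Lemma rnorm0_eq0 V (x : V) : rnorm x = 0 -> x = 0.
Proof. by move=> x0; apply: (@normr0_eq0 R[i] V); rewrite -rnormE x0. Qed.

Lemma ler_rnormD V (x y : V) : rnorm (x + y) <= rnorm x + rnorm y.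
Proof. by rewrite -lecR rmorphD /= !rnormE; exact: (@ler_normD R[i] V). Qed.

Lemma rnormM (x y : R[i]) : rnorm (x * y) = rnorm x * rnorm y.
Proof. by apply: complexI; rewrite rmorphM /= !rnormE normrM. Qed.

Lemma rnormZ (H : normedModType R[i]) (c : R[i]) (x : H) :
  rnorm (c *: x) = rnorm c * rnorm x.
Proof. by apply: complexI; rewrite rmorphM /= !rnormE normrZ. Qed.

Lemma rnorm_real (r : R) : 0 <= r -> rnorm r%:C = r.
Proof. by move=> r0; apply: complexI; rewrite rnormE ger0_norm// lecR. Qed.

End RealNorm.

Section OperatorNorm.
Variables (R : realType) (H : normedModType R[i]).
Implicit Types S : {linear H -> H}.

Lemma has_ubound_opnorm (A : H -> H) : bounded_operator A ->
  has_ubound [set rnorm (A x) | x in [set x : H | rnorm x <= 1]].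
Proof.
move=> [M AM]; exists `|M| => _ [x x1 <-].
apply: le_trans (AM x) _; apply: le_trans (ler_norm _) _.
by rewrite normrM ler_piMr// ger0_norm ?rnorm_ge0.
Qed.

Lemma opnorm_ge0 (A : H -> H) : bounded_operator A -> 0 <= opnorm A.
Proof.
move=> A_bounded; apply: le_trans (rnorm_ge0 (A 0)) _.
apply: ub_le_sup (has_ubound_opnorm A_bounded) _ _.
by exists 0 => //=; rewrite rnorm0 ler01.
Qed.

(** Since [opnorm] is a supremum over the unit ball, the bound at [x] comes from
    its value at [x / |x|]. *)
Lemma ler_opnorm S x : bounded_operator S ->
  rnorm (S x) <= opnorm S * rnorm x.
Proof.
move=> S_bounded; have [x0|x_neq0] := eqVneq (rnorm x) 0.
  by rewrite (rnorm0_eq0 x0) linear0 !rnorm0 mulr0.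
have x_gt0 : 0 < rnorm x by rewrite lt_def x_neq0 rnorm_ge0.
rewrite -ler_pdivrMr// mulrC.
have xV_ge0 : 0 <= (rnorm x)^-1 by rewrite invr_ge0 rnorm_ge0.
rewrite -[X in X * _](rnorm_real xV_ge0) -rnormZ -linearZ.
apply: ub_le_sup (has_ubound_opnorm S_bounded) _ _.
by exists ((rnorm x)^-1%:C *: x) => //=; rewrite rnormZ rnorm_real// mulVf.
Qed.

Lemma opnorm_le (A : H -> H) (c : R) : 0 <= c ->
  (forall x, rnorm (A x) <= c * rnorm x) -> opnorm A <= c.
Proof.
move=> c_ge0 Ac; apply: ge_sup.
  by exists (rnorm (A 0)), 0 => //=; rewrite rnorm0 ler01.
by move=> _ [x x1 <-]; apply: le_trans (Ac x) _; rewrite ler_piMr.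
Qed.

(** Registering the powers of [S] as linear maps makes the results on
    [{linear H -> H}] available for them. *)
Lemma iter_linear S k : linear (iter k S).
Proof. by move=> c x y; elim: k => // k IHk; rewrite !iterS IHk linearP. Qed.

HB.instance Definition _ S k :=
  GRing.isLinear.Build R[i] H H _ (iter k S) (iter_linear S k).

Lemma ler_iter_opnorm S k x : bounded_operator S ->
  rnorm (iter k S x) <= opnorm S ^+ k * rnorm x.
Proof.
move=> S_bounded; elim: k => [|k IHk] /=; first by rewrite mul1r.
apply: le_trans (ler_opnorm _ S_bounded) _.
by rewrite exprS -mulrA ler_wpM2l ?opnorm_ge0.
Qed.

Lemma bounded_operator_iter S k :
  bounded_operator S -> bounded_operator (iter k S).
Proof.
by move=> S_bounded; exists (opnorm S ^+ k) => x; apply: ler_iter_opnorm.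
Qed.

Lemma opnorm_iter_le S k : bounded_operator S ->
  opnorm (iter k S) <= opnorm S ^+ k.
Proof.
move=> S_bounded; apply: opnorm_le => [|x]; last exact: ler_iter_opnorm.
by rewrite exprn_ge0// opnorm_ge0.
Qed.

End OperatorNorm.

(** * Powers of the numerical radius *)

Section NumericalRadius.
Variables (R : realType) (H : normedModType R[i]).
Variable dot : {dot H for @Num.conj R[i]}.
Hypothesis norm_dot : forall x : H, `|x| ^+ 2 = dot x x.

Lemma rnorm_dot_le x y : rnorm (dot x y) <= rnorm x * rnorm y.
Proof.
rewrite -lecR rmorphM /= !rnormE -(@ler_pXn2r _ 2) ?nnegrE ?mulr_ge0//.
by rewrite exprMn !norm_dot dot_CauchySchwarz.
Qed.

Lemma rnorm_line_reflection e z : rnorm e = 1 ->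
  rnorm ((2 * dot z e) *: e - z) = rnorm z.
Proof.
move=> e1; have ee1 : dot e e = 1 by rewrite -norm_dot -rnormE e1 expr1n.
apply: complexI; rewrite !rnormE; apply/eqP.
by rewrite -(@eqrXn2 _ 2)// !norm_dot dnorm_line_reflection.
Qed.

(** This is Buzano's inequality for [<z,e> <e,S^* e>], stated without the
    adjoint: applying [S] to the reflection of [z] in the line of [e] costs at
    most [|S| |z|], and its inner product with [e] is
    [2 <z,e> <S e,e> - <S z,e>]. *)
Lemma Buzano_operator (S : {linear H -> H}) e z :
  bounded_operator S -> rnorm e = 1 ->
  2 * (rnorm (dot z e) * rnorm (dot (S e) e))
    <= rnorm (dot (S z) e) + opnorm S * rnorm z.
Proof.
move=> S_bounded e1.
have reflE : 2 * dot z e * dot (S e) e =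
             dot (S z) e + dot (S ((2 * dot z e) *: e - z)) e.
  by rewrite linearB linearZ /= dotBl dotZl addrC subrK.
have -> : 2 * (rnorm (dot z e) * rnorm (dot (S e) e)) =
          rnorm (2 * dot z e * dot (S e) e).
  rewrite !rnormM mulrA; congr (_ * _ * _).
  by apply: complexI; rewrite rnormE normr_nat rmorph_nat.
rewrite reflE; apply: le_trans (ler_rnormD _ _) _.
rewrite lerD2l; apply: le_trans (rnorm_dot_le _ _) _.
rewrite e1 mulr1; apply: le_trans (ler_opnorm _ S_bounded) _.
by rewrite rnorm_line_reflection.
Qed.

(** Induction on [m]: multiplying the bound by [a = |<T e,e>|], each term of
    the sum grows by a factor [a <= |T|], while the product of [a] with the
    remainder is split by [Buzano_operator], for [z = T e] and the power of [T]
    in the remainder, into the new term of the sum and the new remainder. *)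
Lemma rnorm_dot_expr_le (T : {linear H -> H}) (e : H) m :
  bounded_operator T -> rnorm e = 1 ->
  rnorm (dot (T e) e) ^+ m.+1 <=
    \sum_(1 <= k < m.+1) 1 / 2 ^+ k * opnorm (iter k T) * opnorm T ^+ (m.+1 - k)
    + rnorm (dot (iter m.+1 T e) e) / 2 ^+ m.
Proof.
move=> T_bounded e1.
have T_ge0 : 0 <= opnorm T by exact: opnorm_ge0.
have Te_le : rnorm (T e) <= opnorm T.
  by have := ler_opnorm e T_bounded; rewrite e1 mulr1.
have a_le : rnorm (dot (T e) e) <= opnorm T.
  by apply: le_trans (rnorm_dot_le _ _) _; rewrite e1 mulr1.
elim: m => [|m IHm]; first by rewrite big_geq// add0r expr0 divr1 expr1.
rewrite exprS; apply: le_trans (ler_wpM2l (rnorm_ge0 _) IHm) _.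
rewrite mulrDr [in leRHS]big_nat_recr// -addrA; apply: lerD.
  rewrite mulr_sumr !big_nat; apply: ler_sum => k /andP[_ km].
  rewrite (subSn (ltnW km)) exprSr [leLHS]mulrC [leRHS]mulrA ler_wpM2l//.
  rewrite !mulr_ge0 ?divr_ge0 ?exprn_ge0//.
  by apply: opnorm_ge0; apply: bounded_operator_iter.
have S_bounded := bounded_operator_iter m.+1 T_bounded.
have buzano : 2 * (rnorm (dot (T e) e) * rnorm (dot (iter m.+1 T e) e))
    <= rnorm (dot (iter m.+2 T e) e) + opnorm (iter m.+1 T) * rnorm (T e).
  by rewrite (iterSr m.+1); exact: Buzano_operator.
have ST_le := ler_wpM2l (opnorm_ge0 S_bounded) Te_le.
have pow_gt0 : 0 < 2 ^+ m :> R by rewrite exprn_gt0.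
rewrite subSnn expr1 mulrA.
have -> : 1 / 2 ^+ m.+1 * opnorm (iter m.+1 T) * opnorm T
          + rnorm (dot (iter m.+2 T e) e) / 2 ^+ m.+1
        = (opnorm (iter m.+1 T) * opnorm T
           + rnorm (dot (iter m.+2 T e) e)) / 2 / 2 ^+ m.
  by rewrite exprS; field; rewrite gt_eqF.
by rewrite ler_wpM2r ?invr_ge0 ?(ltW pow_gt0)//; lra.
Qed.

End NumericalRadius.

(** * The nilpotent case *)

Lemma sum_halves (F : numFieldType) n : (0 < n)%N ->
  \sum_(1 <= k < n) 1 / 2 ^+ k = 1 - 1 / 2 ^+ (n - 1) :> F.
Proof.
case: n => // n _; rewrite subn1 /=; elim: n => [|n IHn].
  by rewrite big_geq// expr0 divr1 subrr.
rewrite big_nat_recr//= IHn exprS; field.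
by rewrite expf_neq0.
Qed.

Unset Implicit Arguments.
Set Strict Implicit.

Theorem corollary3p4 (R : realType) (H : completeNormedModType R[i])
    (dot : {dot H for @Num.conj R[i]})
    (norm_dot : forall x : H, `|x| ^+ 2 = dot x x)
    (T : {linear H -> H}) (T_bounded : bounded_operator T)
    (n : nat) (n_ge2 : (2 <= n)%N)
    (T_nilpotent : forall x : H, iter n T x = 0)
    (n_least : forall m : nat, (0 < m < n)%N -> ~ (forall x : H, iter m T x = 0)) :
  numerical_radius dot T
    <= (\sum_(1 <= k < n) 1 / 2 ^+ k * opnorm (iter k T) * opnorm T ^+ (n - k))
         `^ (1 / n%:R)
  /\
  (\sum_(1 <= k < n) 1 / 2 ^+ k * opnorm (iter k T) * opnorm T ^+ (n - k))
      `^ (1 / n%:R)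
    <= (1 - 1 / 2 ^+ (n - 1)) `^ (1 / n%:R) * opnorm T.
Proof.
have T_ge0 : 0 <= opnorm T by exact: opnorm_ge0.
have n_gt0 : (0 < n)%N by exact: ltnW.
have nV_ge0 : 0 <= 1 / n%:R :> R by rewrite divr_ge0.
have rootK (x : R) : 0 <= x -> (x ^+ n) `^ (1 / n%:R) = x.
  by move=> x0; rewrite -powR_mulrn// -powRrM div1r mulfV ?powRr1// pnatr_eq0 -lt0n.
have sum_ge0 : 0 <= \sum_(1 <= k < n)
    1 / 2 ^+ k * opnorm (iter k T) * opnorm T ^+ (n - k) :> R.
  apply: sumr_ge0 => k _; rewrite !mulr_ge0 ?divr_ge0 ?exprn_ge0//.
  by apply: opnorm_ge0; apply: bounded_operator_iter.
split; last first.
  have geo_ge0 : 0 <= 1 - 1 / 2 ^+ (n - 1) :> R.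
    by rewrite subr_ge0 ler_pdivrMr ?exprn_gt0// mul1r exprn_ege1// ler1n.
  rewrite -[X in _ <= _ * X](rootK (opnorm T))// -powRM ?exprn_ge0//.
  apply: ge0_ler_powR => //; rewrite ?nnegrE ?mulr_ge0 ?exprn_ge0//.
  have -> : 1 - 1 / 2 ^+ (n - 1) = \sum_(1 <= k < n) 1 / 2 ^+ k :> R.
    exact/esym/sum_halves.
  rewrite mulr_suml !big_nat; apply: ler_sum => k /andP[_ kn].
  rewrite -mulrA ler_wpM2l ?divr_ge0 ?exprn_ge0//.
  rewrite -[X in _ <= _ ^+ X](subnKC (ltnW kn)) exprD ler_wpM2r ?exprn_ge0//.
  exact: opnorm_iter_le.
(* The unit sphere is empty when [H = 0], and then the supremum is 0. *)
have [sphere0|/set0P sphere_neq0] := eqVneq [set x : H | rnorm x = 1]%classic set0.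
  by rewrite /numerical_radius sphere0 image_set0 sup0 powR_ge0.
apply: ge_sup; first by case: sphere_neq0 => x x1; exists (rnorm (dot (T x) x)), x.
move=> _ [x /= x1 <-]; rewrite -[leLHS]rootK ?rnorm_ge0//.
apply: ge0_ler_powR => //; rewrite ?nnegrE ?exprn_ge0 ?rnorm_ge0//.
have := rnorm_dot_expr_le norm_dot n.-1 T_bounded x1.
by rewrite prednK// T_nilpotent linear0l rnorm0 mul0r addr0.
Qed.
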